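(* For each positive integer $n$, the standard bounded-search presentation $\mathsf{BndPkg}(n)$ makes the relation $R(a,b,n)$ decidable over the completed finite domain $a,b\le n$. Hence the installed presentation uniformly decides both $\operatorname{C}(n)$ and $\operatorname{P}(n)$ (that is, uniformly in $n$ one obtains $\operatorname{C}(n)\vee\neg\operatorname{C}(n)$ and $\operatorname{P}(n)\vee\neg\operatorname{P}(n)$).
   Context: Logic is intuitionistic. For positive integers $a,b,n$: $R(a,b,n)$ means $a>1\wedge b>1\wedge ab=n$; $\operatorname{C}(n)\iff\exists a,b\le n\,R(a,b,n)$; $\operatorname{P}(n)\iff n>1\wedge\forall a,b\le n\,\neg R(a,b,n)$. A bounded-search presentation $\mathsf{BndPkg}(n)$ consists of uniform data: the completed finite type $D_n=\{0,\dots,n\}$, an enumeration $e_n$ of it, the total multiplication $\mu:\mathbb{N}\times\mathbb{N}\to\mathbb{N}$, a decision procedure for equality on $\mathbb{N}$, an exhaustive enumerator of the pairs in $D_n\times D_n$, and a deterministic organization $\rho_n$ of that pair enumeration and of its finite universal fold. *)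

(* Defs.v *)
From mathcomp Require Import all_boot.

Set Implicit Arguments.
Unset Strict Implicit.
Unset Printing Implicit Defensive.

Definition R (a b n : nat) : Prop := 1 < a /\ 1 < b /\ a * b = n.

(* The bounded quantifiers range over {0, ..., n}; as R forces a, b > 1, this
   is the same as ranging over the positive integers up to n. *)
Definition C (n : nat) : Prop := exists a b : nat, a <= n /\ b <= n /\ R a b n.

Definition P (n : nat) : Prop :=
  1 < n /\ forall a b : nat, a <= n -> b <= n -> ~ R a b n.

(* A deterministic organization of a finite enumeration s: a fixed order in
   which its items are visited, together with the conjunctive (universal) fold
   of a Boolean test along that order. *)
Record organization (T : eqType) (s : seq T) := Organization {
  org_order : seq T;
  org_orderP : perm_eq org_order s;
  org_fold : pred T -> bool;
  org_foldE : forall q : pred T,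
    org_fold q = foldr (fun x acc => q x && acc) true org_order }.

(* The domain D_n = {0, ..., n} is 'I_n.+1. *)
Record bnd_presentation (n : nat) := BndPresentation {
  bnd_enum : seq 'I_n.+1;
  bnd_enum_uniq : uniq bnd_enum;
  bnd_enumP : forall a : 'I_n.+1, a \in bnd_enum;
  bnd_mul : nat -> nat -> nat;
  bnd_mulE : forall x y : nat, bnd_mul x y = x * y;
  bnd_eq_dec : forall x y : nat, decidable (x = y);
  bnd_pairs : seq ('I_n.+1 * 'I_n.+1);
  bnd_pairs_uniq : uniq bnd_pairs;
  bnd_pairsP : forall p : 'I_n.+1 * 'I_n.+1, p \in bnd_pairs;
  bnd_org : organization bnd_pairs }.

Definition bnd_forall (n : nat) (B : bnd_presentation n)
    (q : 'I_n.+1 -> 'I_n.+1 -> bool) : bool :=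
  org_fold (bnd_org B) (fun p => q p.1 p.2).

Definition nat_eq_dec : forall x y : nat, decidable (x = y).
Proof. rewrite /decidable; decide equality. Defined.

Definition std_pairs (n : nat) : seq ('I_n.+1 * 'I_n.+1) :=
  [seq (a, b) | a <- enum 'I_n.+1, b <- enum 'I_n.+1].

Lemma std_pairs_uniq (n : nat) : uniq (std_pairs n).
Proof. by apply: allpairs_uniq; rewrite ?enum_uniq // => -[a b] [c d]. Qed.

Lemma std_pairsP (n : nat) (p : 'I_n.+1 * 'I_n.+1) : p \in std_pairs n.
Proof. by case: p => a b; apply: allpairs_f; rewrite mem_enum. Qed.

Definition std_org (T : eqType) (s : seq T) : organization s :=
  @Organization T s s (perm_refl s)
    (fun q => foldr (fun x acc => q x && acc) true s) (fun=> erefl).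

(* The standard presentation visits the pairs in lexicographic order. *)
Definition BndPkg (n : nat) : bnd_presentation n :=
  @BndPresentation n
    (enum 'I_n.+1) (enum_uniq _) (fun a => mem_enum _ a)
    muln (fun _ _ => erefl)
    nat_eq_dec
    (std_pairs n) (std_pairs_uniq n) (@std_pairsP n)
    (std_org (std_pairs n)).

(* Main.v *)
Require Import Defs.
From mathcomp Require Import all_boot.

(** The relation R(a, b, n) is a conjunction of two comparisons and one
    equation between natural numbers, so the equality procedure of a
    presentation computes its truth value (lemma [R_P]).  The fold of a
    presentation visits every pair of D_n x D_n, hence it computes the finite
    universal quantifier over pairs (lemma [bnd_forallE]).  For a Boolean test
    on a finite type, a failure of that quantifier yields an actual
    counterexample, without excluded middle: so the negated fold of ~ R reflects
    the existential statement C(n), and the fold itself, conjoined with 1 < n,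
    reflects P(n).  A proposition reflected by a Boolean is decided, by a
    procedure whose answer is that Boolean ([reflect_decidable]).

    The argument uses only the specification fields of a presentation, so the
    lemmas hold for an arbitrary one: the answers do not depend on the order in
    which the pairs are visited. *)

(** The equation is kept beside the decision because a bare inhabitant of
    [decidable Q] does not reveal which test produced its answer. *)
Lemma reflect_decidable (Q : Prop) (b : bool) :
  reflect Q b -> {d : decidable Q | is_left d = b}.
Proof. by case=> q; [exists (left q) | exists (right q)]. Qed.

(** Conjunction is insensitive to order, so the fold along any rearrangement of
    [s] is the test on all of [s]. *)
Lemma org_fold_all (T : eqType) (s : seq T) (o : organization s) (q : pred T) :
  org_fold o q = all q s.
Proof. by rewrite org_foldE -(perm_all q (org_orderP o)); elim: org_order. Qed.

Section Presentation.

Variables (n : nat) (B : bnd_presentation n).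

Lemma bnd_forallE (q : 'I_n.+1 -> 'I_n.+1 -> bool) :
  bnd_forall B q = [forall a, forall b, q a b].
Proof.
rewrite /bnd_forall org_fold_all; apply/allP/forallP => [qB a | q_ab [a b] _].
  by apply/forallP => b; apply: (qB (a, b)); apply: bnd_pairsP.
by have /forallP := q_ab a; apply.
Qed.

Lemma R_P (a b : nat) :
  reflect (R a b n) [&& 1 < a, 1 < b & is_left (bnd_eq_dec B (bnd_mul B a b) n)].
Proof.
apply: (iffP and3P) => [[a1 b1] | [a1 [b1 abn]]].
  by case: bnd_eq_dec => //= abn _; split=> //; split=> //; rewrite -(bnd_mulE B).
by split=> //; case: bnd_eq_dec => //=; rewrite bnd_mulE.
Qed.

Variable decR : forall a b : 'I_n.+1, decidable (R a b n).

Lemma C_P :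
  reflect (C n) (~~ bnd_forall B (fun a b => ~~ is_left (decR a b))).
Proof.
rewrite bnd_forallE; apply: (iffP forallPn).
  case=> a /forallPn[b]; case: (decR a b) => // Rab _.
  by exists a, b; rewrite !leq_ord.
case=> a [b [a_le_n [b_le_n Rab]]].
(* a <= n and a < n.+1 are convertible, so each bound is itself the proof that
   makes an element of D_n out of the number. *)
exists (Ordinal (a_le_n : a < n.+1)); apply/forallPn.
by exists (Ordinal (b_le_n : b < n.+1)); case: decR.
Qed.

(** The second conjunct of P(n) is the negation of C(n), so this follows from
    the reflection of C(n). *)
Lemma P_P :
  reflect (P n) ((1 < n) && bnd_forall B (fun a b => ~~ is_left (decR a b))).
Proof.
apply: (iffP andP) => [] [n_gt1 noR]; split=> //.
  move=> a b a_le_n b_le_n Rab.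
  by have /C_P : C n; [exists a, b | rewrite noR].
by apply/negPn/C_P => -[a [b [a_le_n [b_le_n]]]]; apply: noR.
Qed.

End Presentation.

Theorem proposition2p4p1 (n : nat) (n_gt0 : 0 < n) :
  { decR : forall a b : 'I_n.+1, decidable (R a b n) &
  { decC : decidable (C n) &
  { decP : decidable (P n) |
    [/\ forall a b : 'I_n.+1,
          is_left (decR a b) =
            [&& 1 < a, 1 < b
              & is_left (bnd_eq_dec (BndPkg n) (bnd_mul (BndPkg n) a b) n)],
        is_left decC = ~~ bnd_forall (BndPkg n) (fun a b => ~~ is_left (decR a b))
      & is_left decP =
          (1 < n) && bnd_forall (BndPkg n) (fun a b => ~~ is_left (decR a b)) ]
  }}}.
Proof.
pose dR (a b : 'I_n.+1) := reflect_decidable _ _ (R_P _ (BndPkg n) a b).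
pose decR a b := sval (dR a b).
have [decC decCE] := reflect_decidable _ _ (C_P _ (BndPkg n) decR).
have [decP decPE] := reflect_decidable _ _ (P_P _ (BndPkg n) decR).
by exists decR, decC, decP; split=> // a b; apply: (svalP (dR a b)).
Qed.
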